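(* Let $1\le n_t\le q$ be integers, let $0<\beta_1<\beta_2<\cdots<\beta_q$ be the eigenvalues of the Hermitian positive definite matrix $\mathbf{\Lambda}\in\mathbb{C}^{q\times q}$, let $\mathbf{X}\in\mathbb{C}^{q\times n_t}$ be a standard complex Gaussian matrix, $\mathbf{H}=\mathbf{\Lambda}^{1/2}\mathbf{X}$ and $\mathbf{W}=\mathbf{H}^H\mathbf{H}$. For $p\in\mathbb{N}$ let $\mu_{\mathbf{W}}(p)=\mathbb{E}[\lambda^p]=\frac{1}{n_t}\mathbb{E}\,\mathrm{tr}[\mathbf{W}^p]$ be the $p$-th moment of an unordered eigenvalue $\lambda$ of $\mathbf{W}$. Then $$\mu_{\mathbf{W}}(p)=\frac{1}{n_t}\sum_{k=q-n_t+1}^{q}\frac{\Gamma(n_t+p+k-q)}{\Gamma(n_t-q+k)}\,\alpha_{k,\,p+k-1},$$ where, for every integer $\tau\ge 0$, the vector $\boldsymbol{\alpha}_\tau=(\alpha_{1,\tau},\dots,\alpha_{q,\tau})^T$ is the solution of the linear system $\mathbf{\Psi}\boldsymbol{\alpha}_\tau=(\beta_1^\tau,\dots,\beta_q^\tau)^T$ with $\mathbf{\Psi}$ the $q\times q$ Vandermonde matrix with entries $\mathbf{\Psi}_{m,n}=\beta_m^{n-1}$, and this solution is given as follows. (i) If $0\le\tau\le q-1$, then $\alpha_{\tau+1,\tau}=1$ and $\alpha_{j,\tau}=0$ for all $j\in\{1,\dots,q\}$ with $j\neq\tau+1$. (ii) If $\tau\ge q$, define $a_1,\dots,a_{q+1}$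 by $\prod_{i=1}^q(X-\beta_i)=\sum_{i=1}^{q+1}a_iX^{i-1}$, and set $a_j=0$ for $j\le 0$ or $j>q+1$. Let $(b_1,\dots,b_{\tau-q+1})$ be the solution of the upper triangular linear system $$\sum_{k=1}^{\tau-q+1}a_{q+1+m-k}\,b_k=\begin{cases}0,&1\le m\le\tau-q,\\-1,&m=\tau-q+1.\end{cases}$$ Then, for every $j\in\{1,\dots,q\}$, $$\alpha_{j,\tau}=\sum_{k=1}^{\tau-q+1}b_k\,a_{j+1-k}.$$
   Context: A standard complex Gaussian matrix has i.i.d. circularly symmetric complex Gaussian entries with mean $0$ and variance $1$. An ''unordered eigenvalue'' of the $n_t\times n_t$ matrix $\mathbf{W}$ is an eigenvalue chosen uniformly at random among its $n_t$ eigenvalues. It is a known result, taken as given, that its probability density on $(0,\infty)$ is $$f_\lambda(\lambda)=\frac{1}{n_t}\sum_{l=1}^{q}\sum_{k=q-n_t+1}^{q}\frac{\lambda^{n_t+k-q-1}e^{-\lambda/\beta_l}\beta_l^{q-n_t-1}}{\Gamma(n_t-q+k)}\,(\mathbf{\Psi}^{-1})_{k,l},$$ where $\mathbf{\Psi}$ is the $q\times q$ Vandermonde matrix $\mathbf{\Psi}_{m,n}=\beta_m^{n-1}$; thus $\mu_{\mathbf{W}}(p)=\int_0^\infty\lambda^pf_\lambda(\lambda)\,d\lambda$. *)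

(* Defs.v *)
From HB Require Import structures.
From mathcomp Require Import all_boot all_order all_algebra.
From mathcomp Require Import all_classical all_reals all_analysis.
From mathcomp.real_closed Require Import complex.

Set Implicit Arguments.
Unset Strict Implicit.
Unset Printing Implicit Defensive.

Import Order.TTheory GRing.Theory Num.Theory.
Import numFieldNormedType.Exports.

Local Open Scope classical_set_scope.
Local Open Scope ring_scope.
Local Open Scope sesquilinear_scope.

(* Indices are 0-based throughout: k : 'I_q stands for the 1-based index
   k.+1, and formulas are written with k.+1 to keep the 1-based shape. *)

Definition Gamma (R : realType) (x : R) : R :=
  Rintegral (@lebesgue_measure R) `]0, +oo[ (fun t => t `^ (x - 1) * expR (- t)).

(* The order on R[i] is such that 0 < z means: z is real and positive. *)
Definition posdefmx (R : realType) (n : nat) (A : 'M[R[i]]_n) : Prop :=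
  A \is hermsymmx /\
  forall x : 'cV[R[i]]_n, x != 0 -> 0 < (x ^t* *m A *m x) 0 0.

(* A positive definite matrix has exactly one such square root. *)
Definition is_sqrtmx (R : realType) (n : nat) (S A : 'M[R[i]]_n) : Prop :=
  posdefmx S /\ S *m S = A.

(* l lists the eigenvalues of A, counted with multiplicity. *)
Definition real_spectrum (R : realType) (n : nat) (A : 'M[R[i]]_n)
    (l : 'I_n -> R) : Prop :=
  char_poly A = \prod_(i < n) ('X - ((l i)%:C%C)%:P).

Section RandomMatrix.
Context (d : measure_display) (T : measurableType d) (R : realType).
Variable P : probability T R.

Definition entry_part (q n : nat) (X : T -> 'M[R[i]]_(q, n))
    (k : 'I_q * 'I_n * bool) (t : T) : R :=
  let z := X t k.1.1 k.1.2 in if k.2 then complex.Re z else complex.Im z.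

Definition mutually_independent (I : finType) (Y : I -> T -> R) : Prop :=
  forall A : I -> set R, (forall i, measurable (A i)) ->
    P (\bigcap_i (Y i @^-1` A i)) = (\prod_i P (Y i @^-1` A i))%E.

(* Circularly symmetric with mean 0 and variance 1: the real and imaginary
   parts are independent centered Gaussians of variance 1/2. *)
Definition std_complex_gaussian (q n : nat) (X : T -> 'M[R[i]]_(q, n)) : Prop :=
  [/\ forall k, measurable_fun setT (entry_part X k),
      forall k (A : set R), measurable A ->
        P (entry_part X k @^-1` A) = normal_prob 0 (Num.sqrt 2^-1) A
    & mutually_independent (entry_part X)].

Definition sigma_matrix (q n : nat) (X : T -> 'M[R[i]]_(q, n)) : set (set T) :=
  <<s [set E | exists k (A : set R),
                 measurable A /\ E = entry_part X k @^-1` A] >>.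

Definition uniform_index (q n : nat) (X : T -> 'M[R[i]]_(q, n))
    (J : T -> 'I_n) : Prop :=
  [/\ forall j, measurable (J @^-1` [set j]),
      forall j, P (J @^-1` [set j]) = (n%:R^-1)%:E
    & forall j E, sigma_matrix X E ->
        (P (J @^-1` [set j] `&` E) = P (J @^-1` [set j]) * P E)%E].

(* lam is an unordered eigenvalue of the real-spectrum random matrix W built
   from X: eig _ t lists the eigenvalues of W t in nondecreasing order (and is
   thus determined by W), and lam picks one of them uniformly at random,
   independently of X. *)
Definition unordered_eigenvalue (q n : nat) (X : T -> 'M[R[i]]_(q, n))
    (W : T -> 'M[R[i]]_n) (lam : T -> R) : Prop :=
  exists (eig : 'I_n -> T -> R) (J : T -> 'I_n),
    [/\ forall t, real_spectrum (W t) (eig ^~ t),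
        forall t (i j : 'I_n), (i <= j)%N -> eig i t <= eig j t,
        uniform_index X J
      & forall t, lam t = eig (J t) t].

Definition has_density_pos (lam : T -> R) (f : R -> R) : Prop :=
  forall A : set R, measurable A ->
    P (lam @^-1` A) =
    (\int[@lebesgue_measure R]_(x in A `&` `]0%R, +oo[) (f x)%:E)%E.

End RandomMatrix.

Section Coefficients.
Context (R : realType) (q : nat).
Variable beta : 'I_q -> R.

(* Psi i j = beta i ^+ j *)
Definition Psi : 'M[R]_q := (Vandermonde q (\row_i beta i))^T.

Definition eig_density (nt : nat) (x : R) : R :=
  nt%:R^-1 *
  \sum_(l < q) \sum_(k < q | (q - nt <= k)%N)
    x ^+ (nt + k.+1 - q - 1) * expR (- x / beta l)
      * beta l ^ (q%:Z - nt%:Z - 1)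
      / Gamma ((nt + k.+1 - q)%:R : R) * invmx Psi k l.

(* 1-based: acoef j is the coefficient of X^(j-1) in prod_i (X - beta_i), and
   0 for j <= 0; for j > q + 1 it vanishes since the degree is q. *)
Definition acoef (j : int) : R :=
  if j is Posz j'.+1 then (\prod_(i < q) ('X - (beta i)%:P))`_j' else 0.

(* Entries m and k of the system are the 1-based m.+1 and k.+1, so that the
   last row, 1-based tau - q + 1, is ord_max. *)
Definition tri_system (tau : nat) (b : 'cV[R]_(tau - q).+1) : Prop :=
  forall m : 'I_(tau - q).+1,
    \sum_(k < (tau - q).+1) acoef (q%:Z + 1 + m.+1%:Z - k.+1%:Z) * b k 0 =
    if m == ord_max then -1 else 0.

End Coefficients.

(* Main.v *)
Require Import Defs.
From HB Require Import structures.
From mathcomp Require Import all_boot all_order all_algebra.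
From mathcomp Require Import all_classical all_reals all_analysis.
From mathcomp.real_closed Require Import complex.
From mathcomp Require Import measurable_realfun.
From mathcomp Require Import zify ring.

Set Implicit Arguments.
Unset Strict Implicit.
Unset Printing Implicit Defensive.

Import Order.TTheory GRing.Theory Num.Theory.
Import numFieldNormedType.Exports.

Local Open Scope classical_set_scope.
Local Open Scope ring_scope.
Local Open Scope sesquilinear_scope.

(** Since [Psi] is a Vandermonde matrix, a column [a] solves the system with
    exponent [tau] iff [sum_j a_j X^j] agrees with [X^tau] at all the [beta_i],
    i.e. iff it is the remainder of [X^tau] modulo [prod_i (X - beta_i)]; the
    triangular system computes (the opposite of) the quotient.
    For the moments, integrating [x^p] against the given density termwise leaves
    Gamma integrals, and summing over [l] turns the entries of the inverse of
    [Psi] into the solutions [alpha].  Independence of the selected index from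
    [X] identifies the law of [lam] with the average of the laws of the ordered
    eigenvalues, which gives the trace formula.  This needs the ordered
    eigenvalues to be measurable functions of [X]; they are, because the power
    sums [tr (W^k)] are, and these determine the largest eigenvalue, then the
    next one, and so on. *)

(** * The Vandermonde system as polynomial division *)

Section VandermondeSystem.
Variables (R : realType) (q : nat) (beta : 'I_q -> R).

Definition vandermonde_sol (tau : nat) : 'cV[R]_q :=
  invmx (Psi beta) *m \col_m (beta m ^+ tau).

Lemma PsiE i j : Psi beta i j = beta i ^+ j.
Proof. by rewrite !mxE. Qed.

Lemma Psi_mulcol (a : 'cV[R]_q) m :
  (Psi beta *m a) m 0 = \sum_(j < q) a j 0 * beta m ^+ j.
Proof. by rewrite mxE; apply: eq_bigr => j _; rewrite PsiE mulrC. Qed.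

Definition monic_vanishing : {poly R} := \prod_(i < q) ('X - (beta i)%:P).

Lemma monic_vanishing_monic : monic_vanishing \is monic.
Proof. exact: monic_prod_XsubC. Qed.

Lemma size_monic_vanishing : size monic_vanishing = q.+1.
Proof.
by rewrite size_prod_XsubC -[X in size X]enumT size_enum_ord.
Qed.

Lemma monic_vanishing_root m : monic_vanishing.[beta m] = 0.
Proof.
by rewrite horner_prod (bigD1 m)//= hornerXsubC subrr mul0r.
Qed.

Lemma acoef_nat n : acoef beta n.+1%:Z = monic_vanishing`_n.
Proof. by []. Qed.

Lemma acoef_le0 (z : int) : z <= 0 -> acoef beta z = 0.
Proof. by case: z => [[|n]|n]. Qed.

Lemma acoef_lead : acoef beta (q%:Z + 1) = 1.
Proof.
have -> : q%:Z + 1 = q.+1%:Z by rewrite -addn1 PoszD.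
rewrite acoef_nat.
by have /monicP := monic_vanishing_monic; rewrite lead_coefE size_monic_vanishing.
Qed.

Lemma acoef_big (z : int) : q%:Z + 1 < z -> acoef beta z = 0.
Proof.
case: z => [[|n]|n] // h.
rewrite acoef_nat nth_default// size_monic_vanishing.
by move: h; rewrite addrC -PoszD ltz_nat add1n ltnS.
Qed.

(** Since [acoef] is 1-based and vanishes at nonpositive integers, the convolution can be written
    without the truncation [k <= i]. *)
Lemma coef_monic_vanishingM (n i : nat) (b : 'I_n -> R) :
  (monic_vanishing * \sum_(k < n) b k *: 'X^k)`_i =
  \sum_(k < n) b k * acoef beta (i.+1%:Z - k%:Z).
Proof.
rewrite mulr_sumr coef_sum; apply: eq_bigr => k _.
rewrite -scalerAr coefZ coefMXn; congr (_ * _).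
case: ltnP => ik.
  by rewrite acoef_le0// subr_le0 lez_nat.
by rewrite -acoef_nat subzn 1?ltnW// subSn.
Qed.

Definition tri_mx (tau : nat) : 'M[R]_((tau - q).+1) :=
  \matrix_(m, k) acoef beta (q%:Z + 1 + m.+1%:Z - k.+1%:Z).

Definition tri_rhs (tau : nat) : 'cV[R]_(tau - q).+1 :=
  \col_m (if m == ord_max then -1 else 0).

Lemma tri_systemE tau b : tri_system beta (tau := tau) b <->
  tri_mx tau *m b = tri_rhs tau.
Proof.
split=> [h|/matrixP h m].
  apply/matrixP => m j; rewrite ord1 !mxE -h.
  by apply: eq_bigr => k _; rewrite !mxE.
by move: (h m 0); rewrite !mxE => <-; apply: eq_bigr => k _; rewrite !mxE.
Qed.

(** Below the diagonal the index exceeds [q + 1], the index of the leading coefficient, so the entry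
    is 0; on the diagonal it equals [q + 1], so the entry is 1. The transpose appears because
    [det_trig] concerns lower triangular matrices. *)
Lemma tri_mx_unit tau : tri_mx tau \in unitmx.
Proof.
rewrite unitmxE -det_tr det_trig.
  rewrite big1 ?unitr1// => i _; rewrite !mxE.
  by rewrite addrK acoef_lead.
apply/is_trig_mxP => i j ij; rewrite !mxE acoef_big//.
by rewrite -addrA ltrDl subr_gt0 ltz_nat.
Qed.

Hypothesis beta_inj : injective beta.

Lemma Psi_unit : Psi beta \in unitmx.
Proof.
rewrite unitmx_tr unitmxE unitfE det_Vandermonde.
apply/prodf_neq0 => i _; apply/prodf_neq0 => j ij.
rewrite !mxE subr_eq0; apply/eqP => /beta_inj e.
by rewrite e ltnn in ij.
Qed.

Lemma vandermonde_sol_unique tau :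
  unique (fun a : 'cV[R]_q => Psi beta *m a = \col_m (beta m ^+ tau))
    (vandermonde_sol tau).
Proof.
split; first by rewrite mulmxA mulmxV ?Psi_unit// mul1mx.
by move=> a ha; rewrite /vandermonde_sol -ha mulmxA mulVmx ?Psi_unit// mul1mx.
Qed.

Lemma vandermonde_solP tau (a : 'cV[R]_q) :
  (forall m, \sum_(j < q) a j 0 * beta m ^+ j = beta m ^+ tau) ->
  vandermonde_sol tau = a.
Proof.
move=> ha; apply: (vandermonde_sol_unique tau).2.
by apply/matrixP => m j; rewrite ord1 Psi_mulcol mxE.
Qed.

(** For [tau < q] the monomial X^tau is its own remainder. *)
Lemma vandermonde_sol_small (tau : 'I_q) : vandermonde_sol tau = delta_mx tau 0.
Proof.
apply: vandermonde_solP => m; rewrite (bigD1 tau)//= mxE !eqxx mul1r.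
by rewrite big1 ?addr0// => j /negPf jtau; rewrite mxE jtau mul0r.
Qed.

(* Multiplying monic_vanishing by the polynomial with coefficients b gives
   - X^tau plus terms of degree less than q; at the roots beta m the product
   vanishes, so the low-degree terms solve the Vandermonde system. *)
Lemma vandermonde_sol_large tau (b : 'cV[R]_(tau - q).+1) (j : 'I_q) :
  (q <= tau)%N -> tri_system beta b ->
  vandermonde_sol tau j 0 =
  \sum_(k < (tau - q).+1) b k 0 * acoef beta (j.+1%:Z + 1 - k.+1%:Z).
Proof.
move=> qtau hb.
pose a : 'cV[R]_q := \col_j
  \sum_(k < (tau - q).+1) b k 0 * acoef beta (j.+1%:Z + 1 - k.+1%:Z).
rewrite (_ : vandermonde_sol tau = a) ?mxE//.
apply: vandermonde_solP => m.
pose B : {poly R} := \sum_(k < (tau - q).+1) b k 0 *: 'X^k.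
(* The two 1-based shifts cancel: the coefficient meant here is that of degree [i - k]. *)
have shift (i k : nat) : i.+1%:Z + 1 - k.+1%:Z = i.+1%:Z - k%:Z.
  by rewrite -[k.+1]addn1 PoszD opprD addrACA subrr addr0.
have coefAB i : (monic_vanishing * B)`_i =
    \sum_(k < (tau - q).+1) b k 0 * acoef beta (i.+1%:Z + 1 - k.+1%:Z).
  by rewrite coef_monic_vanishingM; apply: eq_bigr => k _; rewrite shift.
(* Row [i] of the triangular system is exactly the coefficient of degree [q + i] in the product. *)
have coefAB_high i (lei : (i <= tau - q)%N) :
    (monic_vanishing * B)`_(q + i) = if i == (tau - q)%N then -1 else 0.
  have li : (i < (tau - q).+1)%N by rewrite ltnS.
  have := hb (Ordinal li); rewrite -val_eqE /= => <-.
  rewrite coef_monic_vanishingM; apply: eq_bigr => k _; rewrite mulrC.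
  by congr (acoef _ _ * _); lia.
have sAB : (size (monic_vanishing * B)%R <= tau.+1)%N.
  apply: (leq_trans (size_polyMleq _ _)); rewrite size_monic_vanishing /=.
  have sB : (size B <= (tau - q).+1)%N.
    apply: (leq_trans (size_sum _ _ _)); apply/bigmax_leqP => k _.
    by apply: (leq_trans (size_scale_leq _ _)); rewrite size_polyXn.
  by rewrite (leq_trans (leq_add (leqnn _) sB))// addnS subnKC.
have r0 := monic_vanishing_root m.
have := congr1 (fun x => x * B.[beta m]) r0.
(* Evaluate the product at [beta m] and split the sum at degree [q]; above it only the term of
   degree [tau] survives. *)
rewrite mul0r -hornerM (horner_coef_wide _ sAB) -(subnKC qtau) -addnS big_split_ord /=.
rewrite [X in _ + X](_ : _ = - beta m ^+ tau); last first.
  rewrite (bigD1 ord_max)//= big1 ?addr0.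
    by rewrite coefAB_high// eqxx mulN1r subnKC.
  move=> i /negPf ni; rewrite coefAB_high; last by rewrite -ltnS ltn_ord.
  by rewrite -val_eqE /= in ni; rewrite ni mul0r.
rewrite (subnKC qtau) => /eqP; rewrite subr_eq0 => /eqP <-.
by apply: eq_bigr => i _; rewrite coefAB mxE.
Qed.

Lemma vandermonde_sol_triangular tau : (q <= tau)%N ->
  exists b : 'cV[R]_(tau - q).+1,
    unique (tri_system beta (tau := tau)) b /\
    forall j : 'I_q,
      vandermonde_sol tau j 0 =
      \sum_(k < (tau - q).+1) b k 0 * acoef beta (j.+1%:Z + 1 - k.+1%:Z).
Proof.
move=> qtau; exists (invmx (tri_mx tau) *m tri_rhs tau).
have hb : tri_system beta (invmx (tri_mx tau) *m tri_rhs tau).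
  by apply/tri_systemE; rewrite mulKVmx ?tri_mx_unit.
split; last by move=> j; exact: vandermonde_sol_large.
split=> // b' /tri_systemE <-; by rewrite mulKmx ?tri_mx_unit.
Qed.

End VandermondeSystem.

(** * Gamma integrals with a scale parameter *)

Section GammaIntegrals.
Variable R : realType.
Local Notation mu := (@lebesgue_measure R).
Implicit Types (m : nat) (b x : R).

Lemma ler_expr_expR m x : 0 <= x -> x ^+ m <= m`!%:R * expR x.
Proof.
move=> x0; case: m => [|m].
  by rewrite expr0 fact0 mul1r (le_trans _ (expR_ge1Dx x))// lerDl.
rewrite mulrC -ler_pdivrMr ?ltr0n ?fact_gt0//.
by apply: le_trans (expR_ge1Dxn m x0); rewrite lerDr ler01.
Qed.

Lemma continuous_expr_expRN m b : continuous (fun x => x ^+ m * expR (- x / b)).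
Proof.
move=> x; apply: cvgM; first exact: exprn_continuous.
apply: continuous_comp; last exact: continuous_expR.
by apply: cvgM; [exact: cvgN|exact: cvg_cst].
Qed.

Lemma measurable_expr_expRN m b (D : set R) : measurable D ->
  measurable_fun D (fun x => x ^+ m * expR (- x / b)).
Proof.
move=> mD; apply: measurable_funTS; apply: continuous_measurable_fun.
exact: continuous_expr_expRN.
Qed.

Lemma integrable_expr_expRN m b : 0 < b ->
  mu.-integrable `]0, +oo[ (fun x => (x ^+ m * expR (- x / b))%:E).
Proof.
(* Half of the exponential decay absorbs the power, by x^m <= (m! / r^m) e^(r x); the other half is
   the exponential density of rate [r]. The extra factor [r] in the denominator of [c] cancels the
   one in that density. *)
move=> b0; pose r := (2 * b)^-1.
have r0 : 0 < r by rewrite invr_gt0 mulr_gt0.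
pose c := m`!%:R / r ^+ m.+1.
have c0 : 0 <= c by rewrite divr_ge0// exprn_ge0// ltW.
apply: (@le_integrable _ _ _ mu _ _ _
    (fun x => c%:E * (exponential_pdf r x)%:E)%E) => //.
- by apply/measurable_EFinP; exact: measurable_expr_expRN.
- move=> x /=; rewrite in_itv/= andbT => x0.
  have p0 : 0 <= exponential_pdf r x by rewrite exponential_pdf_ge0// ltW.
  have x0' := ltW x0.
  rewrite lee_fin !ger0_norm ?mulr_ge0 ?exprn_ge0 ?expR_ge0//.
  rewrite (exponential_pdfE _ x0').
  have -> : - x / b = (- r * x) + (- r * x).
    rewrite /r; field; by rewrite gt_eqF.
  rewrite expRD !mulrA ler_wpM2r ?expR_ge0//.
  rewrite mulNr expRN ler_pdivrMr ?expR_gt0//.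
  have := @ler_expr_expR m (r * x) (mulr_ge0 (ltW r0) (ltW x0)).
  rewrite exprMn -ler_pdivlMl ?exprn_gt0//.
  move/le_trans; apply; rewrite le_eqVlt; apply/orP; left; apply/eqP.
  by rewrite /c exprS; field; rewrite expf_neq0 ?gt_eqF.
  by rewrite invr_ge0 exprn_ge0// ltW.
- apply: (@integrableZl _ _ _ mu _ _ c (fun x => (exponential_pdf r x)%:E)) => //.
  exact: integrableS (integrable_exponential_pdf r0).
Qed.

Lemma integral_expr_expRN_scale m b : 0 < b ->
  (\int[mu]_(x in `]0%R, +oo[) (x ^+ m * expR (- x / b))%:E =
   (b ^+ m.+1)%:E * \int[mu]_(x in `]0%R, +oo[) (x ^+ m * expR (- x))%:E)%E.
Proof.
move=> b0.
have mN : measurable_fun (`]0, +oo[ : set R) (fun x : R => x ^+ m * expR (- x)).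
  rewrite (_ : (fun x => _) = (fun x : R => x ^+ m * expR (- x / 1))).
    exact: measurable_expr_expRN.
  by apply/funext => x; rewrite divr1.
(* The substitution x -> b x is performed on the closed half-line; the endpoint is negligible. *)
rewrite integral_itv_obnd_cbnd; last first.
  by apply/measurable_EFinP; exact: measurable_expr_expRN.
have Fd : derive1 (fun x : R => b * x) = cst b.
  by apply/funext => x; rewrite derive1Ml// derive1_id mulr1.
have := @increasing_ge0_integration_by_substitutiony R (fun x => b * x)
  (fun x => x ^+ m * expR (- x / b)) 0.
rewrite mulr0 Fd => ->; last 1 first.
- by move=> x; rewrite in_itv/= andbT => x0; rewrite mulr_ge0 ?expR_ge0// exprn_ge0// ltW.
- rewrite -integral_itv_obnd_cbnd; last first.
    apply/measurable_EFinP; apply: measurable_funTS.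
    apply: continuous_measurable_fun => x.
    apply: cvgM; last exact: cvg_cst.
    apply: (@continuous_comp _ _ _ (fun x => b * x) (fun x => x ^+ m * expR (- x / b))).
      by apply: cvgM; [exact: cvg_cst|exact: cvg_id].
    exact: continuous_expr_expRN.
  rewrite -ge0_integralZl//=.
  + apply: eq_integral => x _; rewrite -EFinM; congr EFin.
    rewrite -[LHS]/((b * x) ^+ m * expR (- (b * x) / b) * b).
    have -> : - (b * x) / b = - x by rewrite mulNr mulrAC divff ?mul1r// gt_eqF.
    by rewrite exprMn exprS; ring.
  + exact/measurable_EFinP.
  + move=> x; rewrite in_itv/= andbT => x0.
    by rewrite lee_fin mulr_ge0 ?expR_ge0// exprn_ge0// ltW.
  + by rewrite lee_fin exprn_ge0// ltW.
- by move=> x y _ _ xy; rewrite ltr_pM2l.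
- by move=> x _; exact: cvg_cst.
- exact: is_cvg_cst.
- exact: is_cvg_cst.
- split.
    by move=> x _; exact: derivableM.
  rewrite mulr0; apply: cvg_at_right_filter.
  rewrite -[X in _ --> X](mulr0 b).
  by apply: cvgM; [exact: cvg_cst|exact: cvg_id].
- exact: gt0_cvgMry.
- apply: continuous_subspaceT; exact: continuous_expr_expRN.
Qed.

Lemma GammaE m : Gamma (m.+1%:R : R) =
  \int[mu]_(x in `]0, +oo[) (x ^+ m * expR (- x)).
Proof.
rewrite /Gamma; apply: eq_Rintegral => x; rewrite inE/= in_itv/= andbT => x0.
by rewrite -natr1 addrK powR_mulrn// ltW.
Qed.

(** [Gamma] is the real part of an extended integral, so integrability is what guarantees that no
    infinite value was collapsed to 0. *)
Lemma EFin_Gamma m : (Gamma (m.+1%:R : R))%:E =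
  (\int[mu]_(x in `]0%R, +oo[) (x ^+ m * expR (- x))%:E)%E.
Proof.
rewrite GammaE /Rintegral fineK// integrable_fin_num//.
rewrite (_ : (fun x => _) = (fun x : R => (x ^+ m * expR (- x / 1))%:E)).
  exact: integrable_expr_expRN.
by apply/funext => x; rewrite divr1.
Qed.

Lemma integral_expr_expRN m b : 0 < b ->
  (\int[mu]_(x in `]0%R, +oo[) (x ^+ m * expR (- x / b))%:E =
   (b ^+ m.+1 * Gamma (m.+1%:R : R))%:E)%E.
Proof. by move=> b0; rewrite integral_expr_expRN_scale// -EFin_Gamma. Qed.

End GammaIntegrals.

(** * Moments of the given density *)

Section DensityMoments.
Variables (R : realType) (q nt : nat) (beta : 'I_q -> R).
Local Notation mu := (@lebesgue_measure R).
Hypothesis beta_gt0 : forall i, 0 < beta i.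

Let coef (l k : 'I_q) : R := nt%:R^-1 *
  (beta l ^ (q%:Z - nt%:Z - 1) / Gamma ((nt + k.+1 - q)%:R : R)
    * invmx (Psi beta) k l).

Let kernel p (l k : 'I_q) (x : R) : R :=
  x ^+ (p + (nt + k.+1 - q - 1)) * expR (- x / beta l).

Lemma expr_eig_density p x : x ^+ p * eig_density beta nt x =
  \sum_(l < q) \sum_(k < q | (q - nt <= k)%N) coef l k * kernel p l k x.
Proof.
rewrite /eig_density mulrCA !mulr_sumr; apply: eq_bigr => l _.
rewrite !mulr_sumr; apply: eq_bigr => k _.
by rewrite /coef /kernel exprD; ring.
Qed.

Lemma integrable_kernel p l k :
  mu.-integrable `]0, +oo[ (fun x => (coef l k * kernel p l k x)%:E).
Proof.
apply: (@integrableZl _ _ _ mu _ _ (coef l k) (fun x => (kernel p l k x)%:E)) => //.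
exact: integrable_expr_expRN.
Qed.

Lemma integrable_expr_eig_density p :
  mu.-integrable `]0, +oo[ (fun x => (x ^+ p * eig_density beta nt x)%:E).
Proof.
rewrite (_ : (fun x => _) = (fun x => \sum_(l < q)
    \sum_(k < q | (q - nt <= k)%N) (coef l k * kernel p l k x)%:E)%E); last first.
  apply/funext => x; rewrite expr_eig_density -sumEFin; apply: eq_bigr => l _.
  by rewrite sumEFin.
apply: integrable_sum => //= l _; apply: integrable_sum => //= k _.
exact: integrable_kernel.
Qed.

Lemma integral_expr_eig_density p :
  (\int[mu]_(x in `]0%R, +oo[) (x ^+ p * eig_density beta nt x)%:E =
  (nt%:R^-1 *
    \sum_(k < q | (q - nt <= k)%N)
      Gamma ((nt + p + k.+1 - q)%:R : R) / Gamma ((nt + k.+1 - q)%:R : R)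
        * vandermonde_sol beta (p + k.+1 - 1) k 0)%:E)%E.
Proof.
transitivity (\int[mu]_(x in `]0%R, +oo[) (\sum_(l < q)
    \sum_(k < q | (q - nt <= k)%N) (coef l k * kernel p l k x)%:E))%E.
  apply: eq_integral => x _; rewrite expr_eig_density -sumEFin.
  by apply: eq_bigr => l _; rewrite sumEFin.
rewrite integral_sum//=; last first.
  move=> l; apply: integrable_sum => //= k _; exact: integrable_kernel.
transitivity (\sum_(l < q) (\sum_(k < q | (q - nt <= k)%N)
   coef l k * (beta l ^+ (nt + p + k.+1 - q) *
     Gamma ((nt + p + k.+1 - q)%:R : R)))%:E)%E.
  apply: eq_bigr => l _; rewrite integral_sum//=; last first.
    by move=> k; exact: integrable_kernel.
  rewrite -sumEFin; apply: eq_bigr => k hk.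
  (* The restriction on [k] gives [q <= nt + k], so the truncated subtractions are exact. *)
  have -> : (nt + p + k.+1 - q = (p + (nt + k.+1 - q - 1)).+1)%N by lia.
  rewrite [RHS]EFinM -integral_expr_expRN//.
  rewrite -(integralZl _ (integrable_expr_expRN _ (beta_gt0 l)))//.
rewrite sumEFin; congr EFin.
rewrite exchange_big/= mulr_sumr; apply: eq_bigr => k hk.
have -> : (p + k.+1 - 1 = p + k)%N by lia.
rewrite /vandermonde_sol mxE !mulr_sumr; apply: eq_bigr => l _.
rewrite mxE /coef.
have b0 : beta l != 0 by rewrite gt_eqF.
(* The sum over [l] is a row of the inverse of [Psi] applied to the powers of [beta]. The exponent
   in the density is an integer, equal to -1 when [nt = q], so the powers are combined using
   [beta l != 0]. *)
have -> : beta l ^+ (p + k) =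
    beta l ^ (q%:Z - nt%:Z - 1) * beta l ^+ (nt + p + k.+1 - q).
  by rewrite !exprnP -expfzDr//; congr exprz; lia.
by ring.
Qed.

End DensityMoments.

(** * Spectra of Gram matrices and traces of their powers *)

Section PowerTraces.

Lemma expmx_conj (F : fieldType) n (P D : 'M[F]_n) p : P \in unitmx ->
  (invmx P *m D *m P) ^+ p = invmx P *m D ^+ p *m P.
Proof.
move=> uP; elim: p => [|p IH]; first by rewrite !expr0 mulmx1 mulVmx.
by rewrite !exprS IH -!mulmxE !mulmxA mulmxK.
Qed.

Lemma diag_mxX (F : fieldType) n (v : 'rV[F]_n) p :
  diag_mx v ^+ p = diag_mx (\row_j (v 0 j ^+ p)).
Proof.
elim: p => [|p IH].
  rewrite expr0; apply/matrixP => i j; rewrite !mxE.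
  by case: eqP => // <-; rewrite expr0.
rewrite exprS IH -mulmxE mulmx_diag; congr diag_mx.
by apply/rowP => j; rewrite !mxE exprS.
Qed.

Lemma char_poly_conj (F : fieldType) n (P A : 'M[F]_n) : P \in unitmx ->
  char_poly (invmx P *m A *m P) = char_poly A.
Proof.
move=> uP; rewrite /char_poly /char_poly_mx !map_mxM/=.
set Q := map_mx _ (invmx P); set Pp := map_mx _ P; set Ap := map_mx _ A.
have QP : Q *m Pp = 1%:M by rewrite -map_mxM/= mulVmx// map_mx1.
have -> : 'X%:M - Q *m Ap *m Pp = Q *m ('X%:M - Ap) *m Pp.
  by rewrite mulmxBr mulmxBl mul_mx_scalar -scalemxAl QP scalemx1.
by rewrite !det_mulmx mulrAC -det_mulmx QP det1 mul1r.
Qed.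

Variable R : realType.

Lemma gram_hermitian q n (H : 'M[R[i]]_(q, n)) : H ^t* *m H \is hermsymmx.
Proof.
apply/is_hermitianmxP; rewrite expr0 scale1r.
by rewrite trmx_mul map_mxM/= trmxCK.
Qed.

Lemma gram_diag_ge0 q n (H : 'M[R[i]]_(q, n)) i : 0 <= (H ^t* *m H) i i.
Proof.
rewrite mxE sumr_ge0// => k _; rewrite !mxE mulrC; exact: mul_conjC_ge0.
Qed.

(** A unitary diagonalization has nonnegative diagonal and the same characteristic polynomial, so
    [l] is a rearrangement of that diagonal; both conclusions are insensitive to order. *)
Lemma gram_spectrum q n (H : 'M[R[i]]_(q, n)) (l : 'I_n -> R) :
  real_spectrum (H ^t* *m H) l ->
  (forall i, 0 <= l i) /\
  forall p, \tr ((H ^t* *m H) ^+ p) = (\sum_(i < n) l i ^+ p)%:C%C.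
Proof.
move=> hl; set W := H ^t* *m H.
have /hermitian_normalmx /orthomx_spectralP := gram_hermitian H.
set P := spectralmx _; set sp := spectral_diag _ => eW.
have uP : P \is unitarymx := spectral_unitarymx _.
have iP : P \in unitmx := spectral_unit _.
have sp0 j : 0 <= sp 0 j.
  (* As [P] is unitary, the adjoint of its inverse is [P], and P W P^-1 is the diagonal form of
     W. *)
  have -> : sp 0 j = ((H *m invmx P) ^t* *m (H *m invmx P)) j j.
    rewrite trmx_mul map_mxM/= mulmxA -[X in _ = (X *m _) _ _]mulmxA eW.
    rewrite !mulmxA mulmxK// [in X in _ = X]invmx_unitary// trmxCK.
    by rewrite (unitarymxP uP) mul1mx mxE eqxx mulr1n.
  exact: gram_diag_ge0.
have pe : perm_eq [seq sp 0 j | j <- index_enum 'I_n] [seq (l j)%:C%C | j <- index_enum 'I_n].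
  apply: prod_XsubC_eq; rewrite !big_map.
  have <- : char_poly W = \prod_(i < n) ('X - (sp 0 i)%:P).
    rewrite /W eW char_poly_conj// char_poly_trig ?diag_mx_is_trig//.
    by apply: eq_bigr => i _; rewrite mxE eqxx mulr1n.
  by rewrite -hl.
split=> [i|p].
  have : (l i)%:C%C \in [seq sp 0 j | j <- index_enum 'I_n].
    by rewrite (perm_mem pe); apply/mapP; exists i; rewrite ?mem_index_enum.
  by case/mapP => j _ e; rewrite -ler0c e.
rewrite /W eW expmx_conj// mxtrace_mulC mulmxA mulmxV// mul1mx diag_mxX mxtrace_diag.
under eq_bigr do rewrite mxE.
rewrite rmorph_sum/=.
under [RHS]eq_bigr do rewrite rmorphXn/=.
transitivity (\sum_(z <- [seq sp 0 j | j <- index_enum 'I_n]) z ^+ p).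
  by rewrite big_map.
by rewrite (perm_big _ pe) big_map.
Qed.

End PowerTraces.

(** * Measurability of ordered eigenvalues through power sums *)

Section MeasurableOrderStatistics.
Context d0 (T0 : measurableType d0) (R : realType).

Lemma ex_expr_gt (c M : R) (n : nat) : 0 <= c < M ->
  exists k, n%:R * c ^+ k < M ^+ k.
Proof.
move=> /andP[c0 cM]; have M0 : 0 < M := le_lt_trans c0 cM.
have z1 : `|c / M| < 1.
  by rewrite ger0_norm ?divr_ge0// 1?ltW// ltr_pdivrMr// mul1r.
(* The powers of [c / M] tend to 0; the threshold uses [n.+1] so that it stays positive for
   [n = 0]. *)
have /cvgrPdist_lt/(_ (n.+1%:R^-1)) := cvg_expr z1.
rewrite invr_gt0 ltr0n => /(_ isT)[k _ /(_ k (leqnn k))] /=.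
rewrite sub0r normrN ger0_norm ?exprn_ge0 ?divr_ge0// 1?ltW//.
rewrite expr_div_n ltr_pdivrMr ?exprn_gt0// mulrC => h.
exists k; apply: (@le_lt_trans _ _ (n.+1%:R * c ^+ k)).
  by rewrite ler_wpM2r ?exprn_ge0// ler_nat.
by rewrite mulrC -ltr_pdivlMr// ltr0n.
Qed.

(* max_i x_i > c iff n * c ^+ k < \sum_i x_i ^+ k for some k. *)
Lemma measurable_max_of_power_sums n (x : 'I_n -> T0 -> R) (M : T0 -> R) :
  (forall i t, 0 <= x i t) ->
  (forall t, (exists i, x i t = M t) /\ forall i, x i t <= M t) ->
  (forall k, measurable_fun setT (fun t => \sum_(i < n) x i t ^+ k)) ->
  measurable_fun setT M.
Proof.
move=> x0 xM mS.
have M0 t : 0 <= M t by have [[i <-] _] := xM t; exact: x0.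
apply: (measurability _ (RGenOInfty.measurableE R)) => _ [_ [c ->] <-].
rewrite setTI; have [c0|c0] := ltP c 0.
  rewrite (_ : _ @^-1` _ = setT)//; apply/seteqP; split=> // t _ /=.
  by rewrite in_itv/= andbT (lt_le_trans c0).
rewrite (_ : _ @^-1` _ =
    \bigcup_k [set t | n%:R * c ^+ k < \sum_(i < n) x i t ^+ k]).
  apply: bigcup_measurable => k _.
  rewrite -[X in measurable X]setTI.
  rewrite (_ : [set t | _] = (fun t => \sum_(i < n) x i t ^+ k) @^-1`
      `]n%:R * c ^+ k, +oo[%classic); first exact: mS.
  by apply/seteqP; split=> t /=; rewrite in_itv/= andbT.
apply/seteqP; split=> t /=; rewrite in_itv/= andbT; last move=> [k _ /=].
  move=> cM.
  have [k hk] : exists k, n%:R * c ^+ k < M t ^+ k.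
    by apply: ex_expr_gt; rewrite c0.
  exists k => //=; apply: (lt_le_trans hk).
  have [[i <-] _] := xM t; rewrite (bigD1 i)//= lerDl sumr_ge0// => j _.
  exact: exprn_ge0.
(* If the maximum is at most [c], each of the [n] terms is at most [c ^+ k]. *)
apply: contraTT; rewrite -!leNgt => Mc.
rewrite mulr_natl -[n in X in _ <= X]card_ord -sumr_const.
apply: ler_sum => i _; rewrite lerXn2r ?nnegrE//.
by apply: le_trans Mc; have [_] := xM t; apply.
Qed.

(** Induction on [n]: the last function is the maximum, hence measurable, and subtracting its powers
    leaves the power sums of the others. *)
Lemma measurable_of_power_sums n (x : 'I_n -> T0 -> R) :
  (forall i t, 0 <= x i t) ->
  (forall t (i j : 'I_n), (i <= j)%N -> x i t <= x j t) ->
  (forall k, measurable_fun setT (fun t => \sum_(i < n) x i t ^+ k)) ->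
  forall i, measurable_fun setT (x i).
Proof.
elim: n x => [x _ _ _ []//|n IH] x x0 xle mS.
have mmax : measurable_fun setT (x ord_max).
  apply: (measurable_max_of_power_sums x0) mS => t; split; first by exists ord_max.
  by move=> i; apply: xle; rewrite -ltnS ltn_ord.
move=> i; have [->//|ni] := eqVneq i ord_max.
have [j ->] : exists j : 'I_n, i = widen_ord (leqnSn n) j.
  have li : (i < n)%N.
    by rewrite ltn_neqAle -ltnS ltn_ord andbT; apply: contra ni => /eqP e; apply/eqP/val_inj.
  by exists (Ordinal li); apply/val_inj.
apply: (IH (fun j => x (widen_ord (leqnSn n) j))) => // [t a b ab|k].
  exact: xle.
have -> : (fun t => \sum_(i < n) x (widen_ord (leqnSn n) i) t ^+ k) =
  (fun t => \sum_(i < n.+1) x i t ^+ k) \- (fun t => x ord_max t ^+ k).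
  by apply/funext => t /=; rewrite big_ord_recr/= addrK.
by apply: measurable_funB => //; exact: measurable_funX.
Qed.

(** Measurability is expressed by real and imaginary parts, the form in which [entry_part] supplies
    it. *)
Definition cmeasurable (f : T0 -> R[i]) :=
  measurable_fun setT (fun t => complex.Re (f t)) /\
  measurable_fun setT (fun t => complex.Im (f t)).

Lemma cmeasurable_cst c : cmeasurable (fun=> c).
Proof. by split; exact: measurable_cst. Qed.

Lemma cmeasurableD f g : cmeasurable f -> cmeasurable g ->
  cmeasurable (fun t => f t + g t).
Proof.
move=> [f1 f2] [g1 g2]; split.
  rewrite (_ : (fun t => _) =
    (fun t => complex.Re (f t)) \+ (fun t => complex.Re (g t))).
    exact: measurable_funD.
  by apply/funext => t /=; case: (f t) => a b; case: (g t).
rewrite (_ : (fun t => _) =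
  (fun t => complex.Im (f t)) \+ (fun t => complex.Im (g t))).
  exact: measurable_funD.
by apply/funext => t /=; case: (f t) => a b; case: (g t).
Qed.

Lemma cmeasurableM f g : cmeasurable f -> cmeasurable g ->
  cmeasurable (fun t => f t * g t).
Proof.
move=> [f1 f2] [g1 g2]; split.
  rewrite (_ : (fun t => _) =
    ((fun t => complex.Re (f t)) \* (fun t => complex.Re (g t))) \-
    ((fun t => complex.Im (f t)) \* (fun t => complex.Im (g t)))).
    by apply: measurable_funB; exact: measurable_funM.
  by apply/funext => t /=; case: (f t) => a b; case: (g t).
rewrite (_ : (fun t => _) =
  ((fun t => complex.Re (f t)) \* (fun t => complex.Im (g t))) \+
  ((fun t => complex.Im (f t)) \* (fun t => complex.Re (g t)))).
  by apply: measurable_funD; exact: measurable_funM.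
by apply/funext => t /=; case: (f t) => a b; case: (g t).
Qed.

Lemma cmeasurable_conj f : cmeasurable f -> cmeasurable (fun t => (f t)^*).
Proof.
move=> [f1 f2]; split.
  rewrite (_ : (fun t => _) = (fun t => complex.Re (f t)))//.
  by apply/funext => t /=; case: (f t).
rewrite (_ : (fun t => _) = \- (fun t => complex.Im (f t))).
  exact: measurable_funN.
by apply/funext => t /=; case: (f t).
Qed.

Lemma cmeasurable_sum (I : Type) (s : seq I) (f : I -> T0 -> R[i]) :
  (forall i, cmeasurable (f i)) -> cmeasurable (fun t => \sum_(i <- s) f i t).
Proof.
move=> hf; elim: s => [|a s IH].
  under eq_fun do rewrite big_nil; exact: cmeasurable_cst.
under eq_fun do rewrite big_cons; exact: cmeasurableD.
Qed.

Definition mxmeasurable m n (A : T0 -> 'M[R[i]]_(m, n)) :=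
  forall i j, cmeasurable (fun t => A t i j).

Lemma mxmeasurable_cst m n (A : 'M[R[i]]_(m, n)) : mxmeasurable (fun=> A).
Proof. by move=> i j; exact: cmeasurable_cst. Qed.

Lemma mxmeasurableM m n p (A : T0 -> 'M[R[i]]_(m, n))
    (B : T0 -> 'M[R[i]]_(n, p)) : mxmeasurable A -> mxmeasurable B ->
  mxmeasurable (fun t => A t *m B t).
Proof.
move=> mA mB i j; under eq_fun do rewrite mxE.
by apply: cmeasurable_sum => k; exact: cmeasurableM.
Qed.

Lemma mxmeasurable_adjoint m n (A : T0 -> 'M[R[i]]_(m, n)) :
  mxmeasurable A -> mxmeasurable (fun t => (A t) ^t*).
Proof.
move=> mA i j; under eq_fun do rewrite !mxE.
exact: cmeasurable_conj.
Qed.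

Lemma mxmeasurableX n (A : T0 -> 'M[R[i]]_n) p :
  mxmeasurable A -> mxmeasurable (fun t => A t ^+ p).
Proof.
move=> mA; elim: p => [|p IH].
  by under eq_fun do rewrite expr0; exact: mxmeasurable_cst.
by under eq_fun do rewrite exprS; exact: mxmeasurableM.
Qed.

(** The power sums are traces, hence polynomials in the entries and their conjugates. The measurable
    space is arbitrary because the result serves both the ambient sigma-algebra and the one
    generated by [X]. *)
Lemma gram_spectrum_measurable q n (H : T0 -> 'M[R[i]]_(q, n))
    (eig : 'I_n -> T0 -> R) : mxmeasurable H ->
  (forall t, real_spectrum ((H t) ^t* *m H t) (eig ^~ t)) ->
  (forall t (i j : 'I_n), (i <= j)%N -> eig i t <= eig j t) ->
  forall i, measurable_fun setT (eig i).
Proof.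
move=> mH hs hle; apply: measurable_of_power_sums => // [i t|k].
  by have [h _] := gram_spectrum (hs t).
have -> : (fun t => \sum_(i < n) eig i t ^+ k) =
    (fun t => complex.Re (\tr (((H t) ^t* *m H t) ^+ k))).
  by apply/funext => t; have [_ ->] := gram_spectrum (hs t).
suff [] : cmeasurable (fun t => \tr (((H t) ^t* *m H t) ^+ k)) by [].
apply: cmeasurable_sum => j; apply: mxmeasurableX.
by apply: mxmeasurableM => //; exact: mxmeasurable_adjoint.
Qed.

End MeasurableOrderStatistics.

(** * Laws of random selections and integration against a density *)

Section Laws.
Local Open Scope ereal_scope.
Context d (T : measurableType d) d' (T' : measurableType d') (R : realType).
Variable P : probability T R.

(** The law of [Z] is the average of the laws of the [Y j], and the integral is linear in the
    measure. *)
Lemma ge0_integral_mixture n (Y : 'I_n -> {RV P >-> T'}) (Z : {RV P >-> T'})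
    (g : T' -> \bar R) :
  (forall A, measurable A ->
    P (Z @^-1` A) = (n%:R^-1)%:E * \sum_(j < n) P (Y j @^-1` A)) ->
  measurable_fun setT g -> (forall y, 0 <= g y) ->
  \int[P]_t g (Z t) = (n%:R^-1)%:E * \sum_(j < n) \int[P]_t g (Y j t).
Proof.
(* For [n = 0] the hypothesis on the whole space would read 1 = 0. *)
case: n Y => [|n] Y hZ mg g0.
  have := hZ _ measurableT.
  by rewrite preimage_setT probability_setT big_ord0 mule0 => /eqP; rewrite onee_eq0.
pose m_ (k : nat) : {measure set T' -> \bar R} := distribution P (Y (inord k)).
have c0 : (0 <= (n.+1%:R : R)^-1)%R by rewrite invr_ge0 ler0n.
transitivity (\int[mscale (NngNum c0) (msum m_ n.+1)]_y g y).
  rewrite -[LHS](ge0_integral_distribution Z mg g0).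
  apply: eq_measure_integral => A mA _.
  rewrite [LHS]hZ//= /mscale/= /msum; congr (_ * _).
  by apply: eq_bigr => j _; rewrite /m_ inord_val.
rewrite ge0_integral_mscale//= ge0_integral_measure_sum//; congr (_ * _).
by apply: eq_bigr => j _; rewrite /m_ inord_val ge0_integral_distribution.
Qed.

Lemma preimage_selection n (Y : 'I_n -> T -> T') (J : T -> 'I_n) (A : set T') :
  (fun t => Y (J t) t) @^-1` A =
  \big[setU/set0]_(j < n) (J @^-1` [set j] `&` Y j @^-1` A).
Proof.
rewrite -bigcup_seq; apply/seteqP; split=> t /=.
  by move=> AY; exists (J t) => //=; rewrite mem_index_enum.
by case=> j _ /= [<-].
Qed.

Lemma measurable_selection n (Y : 'I_n -> T -> T') (J : T -> 'I_n) :
  (forall j, measurable (J @^-1` [set j])) ->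
  (forall j, measurable_fun setT (Y j)) ->
  measurable_fun setT (fun t => Y (J t) t).
Proof.
move=> mJ mY _ A mA; rewrite setTI preimage_selection.
apply: bigsetU_measurable => j _; apply: measurableI => //.
by rewrite -[X in measurable X]setTI; exact: mY.
Qed.

Lemma uniform_selection_law n (Y : 'I_n -> T -> T') (J : T -> 'I_n) :
  (forall j, measurable (J @^-1` [set j])) ->
  (forall j, measurable_fun setT (Y j)) ->
  (forall j A, measurable A ->
    P (J @^-1` [set j] `&` Y j @^-1` A) = (n%:R^-1)%:E * P (Y j @^-1` A)) ->
  forall A, measurable A ->
  P ((fun t => Y (J t) t) @^-1` A) =
    (n%:R^-1)%:E * \sum_(j < n) P (Y j @^-1` A).
Proof.
move=> mJ mY hJ A mA; rewrite preimage_selection measure_bigsetU_ord//=.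
- rewrite ge0_sume_distrr; last by move=> j _; exact: measure_ge0.
  by apply: eq_bigr => j _; exact: hJ.
- move=> j; apply: measurableI => //.
  by rewrite -[X in measurable X]setTI; exact: mY.
- by move=> i j _ _ [t [[/= <- _] [/= <- _]]].
Qed.

(** No sign of [f] is assumed, and that of [eig_density] is not apparent from its formula. So [f] is
    compared with the Radon-Nikodym derivative of the law of [Z]: equal integrals over all
    measurable sets force equality almost everywhere. *)
Lemma ge0_integral_density (mu : {sigma_finite_measure set T' -> \bar R})
    (Z : {RV P >-> T'}) (D : set T') (f : T' -> R) (g : T' -> \bar R) :
  measurable D -> mu.-integrable D (EFin \o f) ->
  (forall A, measurable A -> P (Z @^-1` A) = \int[mu]_(x in A `&` D) (f x)%:E) ->
  measurable_fun setT g -> (forall y, 0 <= g y) ->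
  \int[P]_t g (Z t) = \int[mu]_(x in D) (g x * (f x)%:E).
Proof.
move=> mD intf hf mg g0.
pose nu : {finite_measure set T' -> \bar R} := distribution P Z.
have nu_mu : nu `<< mu.
  apply/null_content_dominatesP => A mA A0.
  rewrite [nu A]hf// null_set_integral//.
  - exact: measurableI.
  - apply: (measurable_funS mD); first exact: subIsetr.
    exact: measurable_int intf.
  - apply/eqP; rewrite eq_le measure_ge0 andbT -A0.
    by apply: le_measure; rewrite ?inE//; exact: measurableI.
have RNf : ae_eq mu setT (Radon_Nikodym_SigmaFinite.f nu mu) ((EFin \o f) \_ D).
  apply: integral_ae_eq => //.
  - exact: Radon_Nikodym_SigmaFinite.f_integrable.
  - by apply/(measurable_restrictT _ mD)/(measurable_int _ intf).
  - move=> E _ mE; rewrite -Radon_Nikodym_SigmaFinite.f_integral//.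
    by rewrite -integral_mkcondr -hf.
transitivity (\int[nu]_y g y); first by rewrite ge0_integral_distribution.
rewrite -(Radon_Nikodym_SigmaFinite.change_of_variables nu_mu)//.
rewrite [RHS]integral_mkcond.
transitivity (\int[mu]_x (g x * ((EFin \o f) \_ D) x)).
  apply: ae_eq_integral => //.
  - apply: emeasurable_funM => //.
    apply: measurable_int; exact: Radon_Nikodym_SigmaFinite.f_integrable.
  - apply: emeasurable_funM => //.
    by apply/(measurable_restrictT _ mD)/(measurable_int _ intf).
  - exact: ae_eqe_mul2l.
apply: eq_integral => x _; rewrite /patch; case: ifPn => //.
by rewrite mule0.
Qed.

End Laws.

(** * The law of the unordered eigenvalue *)

Section EigenvalueLaw.
Context (d : measure_display) (T : measurableType d) (R : realType).
Variables (P : probability T R) (q n : nat).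
Variables (X : T -> 'M[R[i]]_(q, n)) (L : 'M[R[i]]_q).
Variables (eig : 'I_n -> T -> R) (J : T -> 'I_n).
Hypothesis mX : forall k, measurable_fun setT (entry_part X k).
Hypothesis eig_spec :
  forall t, real_spectrum ((L *m X t) ^t* *m (L *m X t)) (eig ^~ t).
Hypothesis eig_le : forall t (i j : 'I_n), (i <= j)%N -> eig i t <= eig j t.
Hypothesis unifJ : uniform_index P X J.

Lemma eig_ge0 i t : 0 <= eig i t.
Proof. by have [h _] := gram_spectrum (eig_spec t). Qed.

Lemma measurable_eig i : measurable_fun setT (eig i).
Proof.
apply: (gram_spectrum_measurable _ eig_spec eig_le).
apply: mxmeasurableM; first exact: mxmeasurable_cst.
by move=> k j; split; [exact: (mX (k, j, true))|exact: (mX (k, j, false))].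
Qed.

Lemma sigma_matrix_eig i (A : set R) : measurable A ->
  sigma_matrix X (eig i @^-1` A).
Proof.
move=> mA; rewrite /sigma_matrix; set G := [set E | _].
(* Independence of [J] covers only events of the sigma-algebra generated by [X], so measurability of
   [eig i] is established again with [T] carrying that sigma-algebra. *)
pose T0 := g_sigma_algebraType G.
have mX0 k (B : set R) : measurable B -> <<s G >> (entry_part X k @^-1` B).
  by move=> mB; apply: sub_sigma_algebra; exists k, B.
suff h : measurable_fun [set: T0] (eig i : T0 -> R).
  by have := h measurableT A mA; rewrite setTI.
apply: (@gram_spectrum_measurable _ T0 R q n (fun t => L *m X t)) => //.
apply: mxmeasurableM; first exact: mxmeasurable_cst.
move=> k j; split=> _ B mB; rewrite setTI.
- exact: (mX0 (k, j, true)).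
- exact: (mX0 (k, j, false)).
Qed.

Let mselect : measurable_fun setT (fun t => eig (J t) t).
Proof.
apply: (@measurable_selection _ _ _ R n eig J); first by case: unifJ.
exact: measurable_eig.
Qed.

Local Notation RT := (measurableTypeR R).

Definition eigRV i : {RV P >-> RT} :=
  HB.pack (eig i : T -> RT) (isMeasurableFun.Build _ _ T RT (eig i) (measurable_eig i)).

Definition selectRV : {RV P >-> RT} :=
  HB.pack ((fun t => eig (J t) t) : T -> RT)
    (isMeasurableFun.Build _ _ T RT (fun t => eig (J t) t) mselect).

Lemma select_law (A : set RT) : measurable A ->
  P (selectRV @^-1` A) = ((n%:R^-1)%:E * \sum_(j < n) P (eigRV j @^-1` A))%E.
Proof.
move=> mA; case: unifJ => mJ PJ indJ.
apply: (@uniform_selection_law _ _ _ RT R P n eig J) => //.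
  exact: measurable_eig.
move=> j B mB; rewrite indJ ?PJ//; exact: sigma_matrix_eig.
Qed.

(** The transfer lemmas want an integrand nonnegative on the whole line; |x|^p is one, and it agrees
    with x^p on the eigenvalues. *)
Let absX p : measurable_fun setT (fun x : RT => (`|x| ^+ p)%:E).
Proof.
by apply/measurable_EFinP; apply: measurable_funX; exact: normr_measurable.
Qed.

Lemma expectation_select_expr p :
  ('E_P[fun t => (eig (J t) t ^+ p)%R] =
   (n%:R^-1)%:E * 'E_P[fun t => (\sum_(j < n) eig j t ^+ p)%R])%E.
Proof.
rewrite unlock.
transitivity (\int[P]_t (`|selectRV t| ^+ p)%:E)%E.
  by apply: eq_integral => t _; rewrite ger0_norm//= eig_ge0.
rewrite (ge0_integral_mixture select_law (absX p)); last first.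
  by move=> y; rewrite lee_fin exprn_ge0.
congr (_ * _)%E; rewrite -ge0_integral_sum//; last first.
  by move=> j; apply: (measurableT_comp (absX p)); exact: measurable_eig.
apply: eq_integral => t _; rewrite sumEFin; congr EFin.
by apply: eq_bigr => j _; rewrite ger0_norm ?eig_ge0.
Qed.

Lemma expectation_density_expr (f : R -> R) p :
  has_density_pos P (fun t => eig (J t) t) f ->
  (@lebesgue_measure R).-integrable `]0, +oo[ (EFin \o f) ->
  ('E_P[fun t => (eig (J t) t ^+ p)%R] =
   \int[@lebesgue_measure R]_(x in `]0%R, +oo[) (x ^+ p * f x)%:E)%E.
Proof.
move=> hf intf; rewrite unlock.
transitivity (\int[P]_t (`|selectRV t| ^+ p)%:E)%E.
  by apply: eq_integral => t _; rewrite ger0_norm//= eig_ge0.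
rewrite (ge0_integral_density _ intf _ (absX p))//.
apply: eq_integral => x; rewrite inE/= in_itv/= andbT => x0.
by rewrite EFinM ger0_norm// ltW.
Qed.

End EigenvalueLaw.

(** * Moment formula and explicit coefficients *)

Theorem mainTheorem1 (R : realType) (d : measure_display)
    (T : measurableType d) (P : probability T R)
    (nt q : nat) (nt_ge1 : (1 <= nt)%N) (nt_le_q : (nt <= q)%N)
    (beta : 'I_q -> R)
    (beta_gt0 : forall i, 0 < beta i)
    (beta_incr : forall i j : 'I_q, (i < j)%N -> beta i < beta j)
    (Lambda : 'M[R[i]]_q) (Lambda_posdef : posdefmx Lambda)
    (Lambda_eig : real_spectrum Lambda beta)
    (Lambda_half : 'M[R[i]]_q) (Lambda_halfP : is_sqrtmx Lambda_half Lambda)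
    (X : T -> 'M[R[i]]_(q, nt)) (X_gaussian : std_complex_gaussian P X)
    (H : T -> 'M[R[i]]_(q, nt)) (H_def : forall t, H t = Lambda_half *m X t)
    (W : T -> 'M[R[i]]_nt) (W_def : forall t, W t = (H t) ^t* *m H t)
    (lam : T -> R) (lamP : unordered_eigenvalue P X W lam)
    (lam_density : has_density_pos P lam (eig_density beta nt)) :
  exists alpha : nat -> 'cV[R]_q,
    [/\ (* alpha tau is the solution of the Vandermonde system *)
        forall tau : nat,
          unique (fun a : 'cV[R]_q => Psi beta *m a = \col_m (beta m ^+ tau))
            (alpha tau),
        (* moments *)
        forall p : nat,
          let mu : R := nt%:R^-1 *
            \sum_(k < q | (q - nt <= k)%N)
              Gamma ((nt + p + k.+1 - q)%:R : R)
                / Gamma ((nt + k.+1 - q)%:R : R)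
                * alpha (p + k.+1 - 1)%N k 0 in
          ('E_P[fun t => (lam t ^+ p)%R] = mu%:E)%E /\
          ((nt%:R^-1)%:E * 'E_P[fun t => complex.Re (\tr (W t ^+ p)%R)]
             = mu%:E)%E,
        (* (i) *)
        forall tau : 'I_q,
          alpha tau tau 0 = 1 /\
          (forall j : 'I_q, j != tau -> alpha tau j 0 = 0)
      & (* (ii) *)
        forall tau : nat, (q <= tau)%N ->
          exists b : 'cV[R]_(tau - q).+1,
            unique (tri_system beta (tau := tau)) b /\
            forall j : 'I_q,
              alpha tau j 0 =
              \sum_(k < (tau - q).+1) b k 0 * acoef beta (j.+1%:Z + 1 - k.+1%:Z)].
Proof.
have beta_inj : injective beta.
  move=> i j e; apply/val_inj; case: (ltngtP i j) => // /beta_incr;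
    by rewrite e ltxx.
exists (vandermonde_sol beta); split.
- exact: vandermonde_sol_unique.
- move=> p mu.
  case: lamP => eig [J [hs hle unifJ hlam]].
  have eig_spec t : real_spectrum
      ((Lambda_half *m X t) ^t* *m (Lambda_half *m X t)) (eig ^~ t).
    by have := hs t; rewrite W_def H_def.
  have mX : forall k, measurable_fun setT (entry_part X k) by case: X_gaussian.
  have lamE : lam = fun t => eig (J t) t by exact/funext.
  have Elam : ('E_P[fun t => (lam t ^+ p)%R] = mu%:E)%E.
    rewrite lamE in lam_density *.
    rewrite (expectation_density_expr mX eig_spec hle unifJ p lam_density).
      exact: integral_expr_eig_density.
    (* Integrability of the density itself is the case of exponent 0. *)
    have := @integrable_expr_eig_density R q nt beta beta_gt0 0.
    by congr (_.-integrable _ _); apply/funext => x /=; rewrite expr0 mul1r.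
  split=> //; rewrite -Elam lamE.
  rewrite (expectation_select_expr mX eig_spec hle unifJ p).
  congr (_ * _)%E; congr expectation; apply/funext => t.
  (* The trace is a real number, so taking its real part loses nothing. *)
  by rewrite W_def H_def; have [_ ->] := gram_spectrum (eig_spec t).
- move=> tau; rewrite vandermonde_sol_small// mxE !eqxx; split=> // j /negPf jt.
  by rewrite mxE jt.
- exact: vandermonde_sol_triangular.
Qed.
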